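(* Fix $p\in(2,\infty)$ and suppose a set of radial sequences $\{r_{q,d}\in(0,\infty): q\in(0,p],\ d\in\mathbb{N}\}$ satisfies $$r_d:=\inf_{q\in(0,p]} r_{q,d}/r^*_{q,d}\to\infty\quad(d\to\infty).$$ Let $\kappa_d:=\left[r_d\sqrt{d\sigma_p^2}+d\mu_p\right]^{1/p}$ and $\mathbb{V}_{p,d}:=\bigcup_{q\in(0,p]}\mathbb{V}^d_q(r_{q,d})$. Then the sequence of tests $\mathbf{1}\{\|\cdot\|_p\ge\kappa_d\}$ is minimax rate consistent in the sequence of testing problems $H_{0,d}:\boldsymbol{\theta}_d=\boldsymbol{0}_d$ vs. $H_{1,d}:\boldsymbol{\theta}_d\in\mathbb{V}_{p,d}$; that is, $$\mathbb{P}\left(\|\boldsymbol{\varepsilon}_d\|_p\ge\kappa_d\right)+1-\inf_{\boldsymbol{\theta}_d\in\mathbb{V}_{p,d}}\mathbb{P}\left(\|\boldsymbol{\theta}_d+\boldsymbol{\varepsilon}_d\|_p\ge\kappa_d\right)\to0\quad(d\to\infty).$$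
   Context: Let $\varepsilon_1,\varepsilon_2,\dots$ be i.i.d. standard normal random variables and $\boldsymbol{\varepsilon}_d = (\varepsilon_1,\dots,\varepsilon_d)$. For $p\in(0,\infty)$, $\mu_p:=\mathbb{E}(|\varepsilon_1|^p)$ and $\sigma_p^2:=\mathrm{Var}(|\varepsilon_1|^p)$. For $\boldsymbol{x}\in\mathbb{R}^d$ and $q\in(0,\infty)$, $\|\boldsymbol{x}\|_q:=(\sum_{i=1}^d|x_i|^q)^{1/q}$ (also for $q<1$). For $q\in(0,\infty)$ and $r\in(0,\infty)$, $\mathbb{V}^d_q(r):=\{\boldsymbol{\theta}_d\in\mathbb{R}^d:\|\boldsymbol{\theta}_d\|_q\ge r\}$. The critical radii are $r^*_{q,d}:=d^{\frac{4-q}{4q}}$ if $q\in(0,2]$ and $r^*_{q,d}:=d^{\frac{1}{2q}}$ if $q\in(2,\infty)$. *)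

(* Defs.v *)
From HB Require Import structures.
From mathcomp Require Import all_boot all_order all_algebra.
From mathcomp Require Import finmap.
From mathcomp Require Import all_classical all_reals all_analysis.

Set Implicit Arguments.
Unset Strict Implicit.
Unset Printing Implicit Defensive.

Import Order.TTheory GRing.Theory Num.Theory.
Import numFieldNormedType.Exports.

Local Open Scope classical_set_scope.
Local Open Scope ring_scope.

Definition mutually_independent {disp : measure_display}
    {T : measurableType disp} {R : realType} (P : probability T R)
    {I : choiceType} (X : I -> {RV P >-> R}) : Prop :=
  forall (J : {fset I}) (B : I -> set R), (forall i, measurable (B i)) ->
    P (\bigcap_(i in [set` J]) (X i @^-1` B i)) =
    (\prod_(i <- J) P (X i @^-1` B i))%E.

(* The laws are compared on measurable sets only: a [probability] is
   unconstrained outside the sigma-algebra. *)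
Definition standard_normal {disp : measure_display}
    {T : measurableType disp} {R : realType} (P : probability T R)
    (X : {RV P >-> R}) : Prop :=
  forall A : set R, measurable A -> distribution P X A = normal_prob 0 1 A.

Definition iid_standard_normal {disp : measure_display}
    {T : measurableType disp} {R : realType} (P : probability T R)
    (eps : nat -> {RV P >-> R}) : Prop :=
  mutually_independent eps /\ forall i, standard_normal (eps i).

(* The random variables are numbered from 0, so that this is
   (eps 0, ..., eps (d - 1)). *)
Definition noise {disp : measure_display} {T : measurableType disp}
    {R : realType} {P : probability T R} (eps : nat -> {RV P >-> R})
    (d : nat) (w : T) : 'rV[R]_d :=
  \row_(i < d) eps i w.

(* [fine] loses nothing here: all absolute moments of a normal variable are
   finite. *)
Definition mu_abs {disp : measure_display} {T : measurableType disp}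
    {R : realType} (P : probability T R) (X : {RV P >-> R}) (p : R) : R :=
  fine ('E_P[(fun w => (`|X w| `^ p)%R)])%E.

Definition sigma2_abs {disp : measure_display} {T : measurableType disp}
    {R : realType} (P : probability T R) (X : {RV P >-> R}) (p : R) : R :=
  fine ('V_P[(fun w => (`|X w| `^ p)%R)])%E.

Definition lq_norm {R : realType} {d : nat} (q : R) (x : 'rV[R]_d) : R :=
  (\sum_(i < d) `|x 0 i| `^ q) `^ q^-1.

Definition alternative {R : realType} {d : nat} (q r : R) : set 'rV[R]_d :=
  [set theta | r <= lq_norm q theta].

Definition critical_radius {R : realType} (q : R) (d : nat) : R :=
  if q <= 2 then d%:R `^ ((4 - q) / (4 * q)) else d%:R `^ (2 * q)^-1.

(* For d >= 1 the set is nonempty and bounded below by 0, so that the real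
   infimum [inf] is the genuine one. *)
Definition inf_ratio {R : realType} (p : R) (r : R -> nat -> R) (d : nat) : R :=
  inf [set r q d / critical_radius q d | q in `]0, p]].

Definition kappa {disp : measure_display} {T : measurableType disp}
    {R : realType} (P : probability T R) (X : {RV P >-> R})
    (p : R) (r : R -> nat -> R) (d : nat) : R :=
  (inf_ratio p r d * Num.sqrt (d%:R * sigma2_abs X p) + d%:R * mu_abs X p)
    `^ p^-1.

Definition alternative_union {R : realType} (p : R) (r : R -> nat -> R) (d : nat) :
    set 'rV[R]_d :=
  \bigcup_(q in `]0, p]) alternative q (r q d).

Arguments alternative_union {R} p r d _.

(* The event that the test 1{||.||_p >= c} rejects when the mean vector is
   [theta]. *)
Definition rejects {disp : measure_display} {T : measurableType disp}
    {R : realType} {P : probability T R} (eps : nat -> {RV P >-> R})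
    (p c : R) {d : nat} (theta : 'rV[R]_d) : set T :=
  [set w | c <= lq_norm p (theta + noise eps d w)].

(* Main.v *)
(* Let A(theta) = sum_i (theta_i^2 + |theta_i|^p) and let S be the sum of the
   |theta_i + eps_i|^p. Every alternative satisfies A >= r_d^2 sqrt d: for q <= 2
   by comparison of power means, for 2 < q <= p because |x|^q <= x^2 + |x|^p.
   By symmetry of the noise, E|x + eps|^p is the mean of
   (|x + eps|^p + |x - eps|^p) / 2 >= (x^2 + eps^2)^(p/2), whence
   E S >= d mu_p + c A. Moreover Var |x + eps|^p <= C (1 + |x|^(2p-2)), whence
   Var S <= C (d + A^(2-2/p)). Chebyshev's inequality then bounds the type II error
   by a multiple of r_d^(-4/p) and the type I error by r_d^(-2). *)

Require Import Defs.
From HB Require Import structures.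
From mathcomp Require Import all_boot all_order all_algebra.
From mathcomp Require Import finmap ring lra.
From mathcomp Require Import all_classical all_reals all_analysis measurable_realfun.

Set Implicit Arguments.
Unset Strict Implicit.
Unset Printing Implicit Defensive.

Import Order.TTheory GRing.Theory Num.Theory.
Import numFieldNormedType.Exports.

Local Open Scope classical_set_scope.
Local Open Scope ring_scope.

(** The exponent in the variance bound is decisive. The crude estimate Var |x + eps|^p <= E |x +
    eps|^(2p) would sum to order A^2 when one coordinate dominates, the same order as the squared
    gain (c A)^2, and Chebyshev would give nothing. Centring at |x|^p instead saves two powers of
    |x|, so the quotient is at most a constant times A^(-2/p) + d / A^2. As A >= r_d^2 sqrt d >=
    r_d^2, the first term is at most r_d^(-4/p) and the second at most r_d^(-4). The gain in the
    mean must contain both x^2, which carries signals spread over many small coordinates, and |x|^p,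
    which carries a few large ones. All constants depend on p alone, so the bounds are uniform in d,
    in q and in the alternative. Since the exponents are real, the convexity estimates all come from
    one tangent line inequality. *)

(** * Convexity and growth inequalities for real powers *)

Section powR_inequalities.
Context {R : realType}.
Implicit Types a b e m p q s t u v x : R.

Lemma ler_powR2r p x y : 0 <= p -> 0 <= x -> x <= y -> x `^ p <= y `^ p.
Proof.
by move=> p0 x0 xy; rewrite ge0_ler_powR// nnegrE// (le_trans x0).
Qed.

Lemma powR_tangent m t u : 1 < m -> 0 <= t -> 0 <= u ->
  t `^ m + m * t `^ (m - 1) * (u - t) <= u `^ m.
Proof.
move=> m1 t0 u0; have m0 : 0 < m by lra.
have m10 : 0 < m - 1 by lra.
have := @conjugate_powR R u (t `^ (m - 1)) m (m / (m - 1)) u0 (powR_ge0 _ _) m0.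
rewrite divr_gt0// -powRrM (_ : (m - 1) * (m / (m - 1)) = m); last first.
  by field; rewrite gt_eqF.
rewrite (_ : m^-1 + _ = 1) => [|]; last by field; rewrite !gt_eqF.
move=> /(_ isT erefl); rewrite -(ler_pM2l m0).
rewrite (_ : m * (u `^ m / m + t `^ m / (m / (m - 1))) =
  u `^ m + (m - 1) * t `^ m); last by field; rewrite !gt_eqF.
rewrite -(mulr_powRB1 t0 m0); lra.
Qed.

(** Add the tangent bounds at the midpoint: the linear terms are opposite and cancel. *)
Lemma powR_midpoint m s t : 1 < m -> 0 <= s -> 0 <= t ->
  2 * ((s + t) / 2) `^ m <= s `^ m + t `^ m.
Proof.
move=> m1 s0 t0; have c0 : 0 <= (s + t) / 2 by lra.
have := powR_tangent m1 c0 s0; have := powR_tangent m1 c0 t0.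
set c := (s + t) / 2 in c0 *; set k := m * _.
have -> : s - c = - (t - c) by rewrite /c; field.
lra.
Qed.

Lemma powR_superadditive m s t : 1 < m -> 0 <= s -> 0 <= t ->
  s `^ m + t `^ m <= (s + t) `^ m.
Proof.
move=> m1 s0 t0; have m0 : 0 < m by lra.
rewrite -(mulr_powRB1 s0 m0) -(mulr_powRB1 t0 m0).
rewrite -(mulr_powRB1 (addr_ge0 s0 t0) m0) mulrDl.
by apply: lerD; apply: ler_wpM2l => //; apply: ler_powR2r; lra.
Qed.

Lemma powR_norm_sqr p x : `|x| `^ p = (x ^+ 2) `^ (p / 2).
Proof.
rewrite -real_normK ?num_real// -powR_mulrn// -powRrM.
by congr (_ `^ _); field.
Qed.

(** The squares of [a + b] and [a - b] have mean [a ^+ 2 + b ^+ 2], so the right side is at least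
    twice the power [p / 2] of that sum. One copy is bounded by superadditivity, which yields the
    term in |a|^p, the other by the tangent at [b ^+ 2], which yields the term in a^2. *)
Lemma powR_norm_symmetrized p a b : 2 < p ->
  2 * `|b| `^ p + `|a| `^ p + p / 2 * a ^+ 2 * `|b| `^ (p - 2)
  <= `|a + b| `^ p + `|a - b| `^ p.
Proof.
move=> p2; have m1 : 1 < p / 2 by lra.
have sa := sqr_ge0 a; have sb := sqr_ge0 b.
have := powR_midpoint m1 (sqr_ge0 (a + b)) (sqr_ge0 (a - b)).
rewrite (_ : _ / 2 = a ^+ 2 + b ^+ 2); last by field.
have := powR_superadditive m1 sa sb.
have := powR_tangent m1 sb (addr_ge0 sa sb).
rewrite !(powR_norm_sqr p) (powR_norm_sqr (p - 2)).
rewrite (_ : (p - 2) / 2 = p / 2 - 1); last by field.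
rewrite addrK; lra.
Qed.

Lemma powR_dist_le p u v M : 1 < p -> 0 <= u <= M -> 0 <= v <= M ->
  `|u `^ p - v `^ p| <= p * M `^ (p - 1) * `|u - v|.
Proof.
move=> p1 /andP[u0 uM] /andP[v0 vM].
have H x y : 0 <= x <= M -> 0 <= y ->
    x `^ p - y `^ p <= p * M `^ (p - 1) * `|x - y|.
  move=> /andP[x0 xM] y0; have := powR_tangent p1 x0 y0.
  have : p * x `^ (p - 1) * (x - y) <= p * M `^ (p - 1) * `|x - y|.
    apply: le_trans (_ : p * x `^ (p - 1) * `|x - y| <= _).
      by rewrite ler_wpM2l ?ler_norm// mulr_ge0 ?powR_ge0//; lra.
    by rewrite ler_wpM2r// ler_wpM2l ?ler_powR2r//; lra.
  rewrite -(opprB x y) mulrN; lra.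
rewrite ler_norml H ?u0// andbT lerNl opprB distrC H ?v0//.
Qed.

(** The sum is at most twice the larger summand. *)
Lemma powR_add_le p x y : 0 <= p -> 0 <= x -> 0 <= y ->
  (x + y) `^ p <= 2 `^ p * (x `^ p + y `^ p).
Proof.
move=> p0.
have H a b : 0 <= a -> a <= b -> (a + b) `^ p <= 2 `^ p * (a `^ p + b `^ p).
  move=> a0 ab; apply: le_trans (_ : (2 * b) `^ p <= _).
    by apply: ler_powR2r => //; lra.
  rewrite powRM; [|lra|lra].
  by rewrite ler_wpM2l ?powR_ge0// lerDr powR_ge0.
move=> x0 y0; have [xy|/ltW yx] := leP x y; first exact: H.
by rewrite addrC (addrC (x `^ p)); exact: H.
Qed.

Lemma powR_norm_shift_sqr_le p x e : 1 < p ->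
  (`|x + e| `^ p - `|x| `^ p) ^+ 2 <=
  p ^+ 2 * 2 `^ (2 * p - 2) *
    (`|x| `^ (2 * p - 2) * `|e| `^ 2 + `|e| `^ (2 * p)).
Proof.
move=> p1; have ne := normr_ge0 e; have nx := normr_ge0 x.
set M := `|x| + `|e|; have M0 : 0 <= M by rewrite addr_ge0.
have : (`| `|x + e| `^ p - `|x| `^ p| <= p * M `^ (p - 1) * `|e|).
  apply: le_trans (powR_dist_le (M := M) p1 _ _) _.
  - by rewrite normr_ge0 ler_normD.
  - by rewrite nx lerDl.
  - rewrite ler_wpM2l ?mulr_ge0 ?powR_ge0 ?(le_trans _ (ler_dist_dist _ _))//.
      lra.
    by rewrite (le_trans (ler_dist_dist _ _))// addrC addKr.
rewrite -ler_sqr ?nnegrE ?mulr_ge0 ?powR_ge0//; last lra.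
rewrite real_normK ?num_real// => /le_trans; apply.
have -> : (p * M `^ (p - 1) * `|e|) ^+ 2 =
    p ^+ 2 * (M `^ (2 * p - 2) * `|e| ^+ 2).
  rewrite !exprMn -[(M `^ _) ^+ 2]powR_mulrn ?powR_ge0// -powRrM.
  by rewrite (_ : (p - 1) * 2%:R = 2 * p - 2) ?mulrA//; ring.
rewrite -(mulrA (p ^+ 2)) ler_wpM2l ?sqr_ge0//.
(* Factoring out |e|^2 leaves [powR_add_le] at exponent 2p - 2. *)
rewrite (_ : (`|e| `^ (2 * p) = `|e| `^ (2 * p - 2) * `|e| `^ 2)); last first.
  by rewrite -powRD ?subrK// gt_eqF//; lra.
rewrite -mulrDl mulrA (powR_mulrn 2)// ler_wpM2r ?sqr_ge0//.
by apply: powR_add_le; lra.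
Qed.

Lemma powR_le_add2 p q x : 2 <= q <= p -> 0 <= x -> x `^ q <= x ^+ 2 + x `^ p.
Proof.
move=> /andP[q2 qp] x0; have [x1|x1] := leP 1 x.
  by rewrite (le_trans (ler_powR x1 qp))// lerDr sqr_ge0.
have [->|xn0] := eqVneq x 0.
  by rewrite powR0 ?addr_ge0 ?powR_ge0 ?sqr_ge0// gt_eqF//; lra.
rewrite -powR_mulrn// (le_trans (ger_powR _ q2)) ?lerDl ?powR_ge0//.
by rewrite lt_neqAle eq_sym xn0 x0 ltW.
Qed.

End powR_inequalities.

(** * Integration against a measure with a density *)

Section density.
Context d (T : measurableType d) (R : realType).
Local Open Scope ereal_scope.
Import HBNNSimple.

(** Monotone convergence on both sides reduces the claim to simple functions, and linearity reduces
    it to indicators, where it is the hypothesis on [nu]. *)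
Lemma ge0_integral_density (mu nu : {measure set T -> \bar R}) (f : T -> R)
    (g : T -> \bar R) :
  measurable_fun [set: T] f -> (forall x, (0 <= f x)%R) ->
  (forall A, measurable A -> nu A = \int[mu]_(x in A) (f x)%:E) ->
  measurable_fun [set: T] g -> (forall x, 0 <= g x) ->
  \int[nu]_x g x = \int[mu]_x (g x * (f x)%:E).
Proof.
move=> mf f0 nuE mg g0; pose h := nnsfun_approx measurableT mg.
have mfE : measurable_fun [set: T] (EFin \o f) by exact/measurable_EFinP.
have gE x : g x = lim ((EFin \o h n) x @[n --> \oo]).
  by apply/esym/cvg_lim => //; exact: cvg_nnsfun_approx.
have -> : \int[nu]_x g x = lim (\int[nu]_x (EFin \o h n) x @[n --> \oo]).
  under eq_integral do rewrite gE.
  apply: monotone_convergence => //.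
  - by move=> n; exact/measurable_EFinP.
  - by move=> n x _; rewrite lee_fin.
  - by move=> x _ a b ab; rewrite lee_fin; exact/lefP/nd_nnsfun_approx.
have -> : \int[mu]_x (g x * (f x)%:E) =
    lim (\int[mu]_x ((EFin \o h n) x * (f x)%:E) @[n --> \oo]).
  have gfE x : g x * (f x)%:E = lim ((EFin \o h n) x * (f x)%:E @[n --> \oo]).
    by apply/esym/cvg_lim => //; apply: cvgeZr => //; exact: cvg_nnsfun_approx.
  under eq_integral do rewrite gfE.
  apply: monotone_convergence => //.
  - by move=> n; apply: emeasurable_funM => //; exact/measurable_EFinP.
  - by move=> n x _; rewrite mule_ge0 ?lee_fin.
  - move=> x _ a b ab; rewrite lee_wpmul2r ?lee_fin//.
    exact/lefP/nd_nnsfun_approx.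
suff suf n : \int[mu]_x ((EFin \o h n) x * (f x)%:E) = \int[nu]_x (EFin \o h n) x.
  by under [in RHS]eq_fun do rewrite suf.
apply/esym.
transitivity (\int[nu]_x
   (\sum_(y \in range (h n)) (y * \1_(h n @^-1` [set y]) x)%:E)).
  by apply: eq_integral => t _; rewrite /= fimfunE -fsumEFin.
have indich r : measurable_fun [set: T] (fun x => (r * \1_(h n @^-1` [set r]) x)%:E).
  by apply/measurable_EFinP; exact: measurable_funM.
rewrite ge0_integral_fsum//; last by move=> y x _; exact: nnfun_muleindic_ge0.
transitivity (\int[mu]_x (\sum_(y \in range (h n))
    ((y * \1_(h n @^-1` [set y]) x)%:E * (f x)%:E))); last first.
  apply: eq_integral => x _.
  rewrite -ge0_mule_fsuml => [|y]; last exact: nnfun_muleindic_ge0.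
  by rewrite fsumEFin // -(fimfunE _ x).
rewrite ge0_integral_fsum//; last 2 first.
- by move=> y; exact: emeasurable_funM.
- by move=> y x _; rewrite mule_ge0 ?lee_fin// -lee_fin nnfun_muleindic_ge0.
apply: eq_fsbigr => r rhn.
under eq_integral do rewrite EFinM.
rewrite integralZl_indic_nnsfun => //.
under [RHS]eq_integral do rewrite EFinM -muleA.
have r0 : (0 <= r)%R by move: rhn; rewrite inE => -[x _ <-].
rewrite ge0_integralZl//; last 2 first.
- by apply: emeasurable_funM => //; exact/measurable_EFinP.
- by move=> x _; rewrite mule_ge0 ?lee_fin.
congr *%E; rewrite integral_indic// setIT nuE//.
rewrite integral_mkcond/=; apply: eq_integral => x _.
by rewrite muleC epatch_indic.
Qed.

End density.

(** * Symmetry and finite absolute moments of the normal law *)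

(** The factor 1/4 is half of the rate in the Gaussian density, so that the product with that
    density still decays like a Gaussian. *)
Lemma powR_norm_le_expR (R : realType) (s : R) : 0 <= s ->
  exists2 C : R, 0 <= C & forall x : R, `|x| `^ s <= C * expR (x ^+ 2 / 4).
Proof.
move=> s0; pose n := Num.truncn s.
(* The summand 1 serves |x| <= 1. For |x| >= 1, |x|^s is at most |x|^(2(n+1)), which a single term
   of the exponential series at x^2 / 4 controls. *)
exists (1 + 4 ^+ n.+1 * n.+1`!%:R) => [|x]; first by rewrite addr_ge0 ?mulr_ge0.
have y0 : 0 <= x ^+ 2 / 4 by rewrite divr_ge0 ?sqr_ge0.
have e1 : 1 <= expR (x ^+ 2 / 4) by have := expR_ge1Dx (x ^+ 2 / 4); lra.
rewrite mulrDl mul1r.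
have [x1|/ltW x1] := leP `|x| 1.
  rewrite (@le_trans _ _ 1)// ?ler_wpDr ?mulr_ge0 ?expR_ge0//.
  by rewrite -(congr1 (fun f => f s) (@powR1 R)) ler_powR2r.
rewrite ler_wpDl ?expR_ge0//.
apply: le_trans (_ : `|x| `^ (2 * n.+1)%:R <= _).
  apply: ler_powR => //; apply: (le_trans (ltW (truncnS_gt s))).
  by rewrite ler_nat leq_pmull.
have := expR_ge1Dxn n y0.
rewrite powR_mulrn// exprM real_normK ?num_real// => H.
have {H} : (x ^+ 2 / 4) ^+ n.+1 / n.+1`!%:R <= expR (x ^+ 2 / 4) by lra.
rewrite ler_pdivrMr ?ltr0n ?fact_gt0// expr_div_n ler_pdivrMr ?exprn_gt0//.
by move=> /le_trans; apply; rewrite mulrC mulrA mulrAC.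
Qed.

Lemma measurable_powR_norm (R : realType) (s : R) :
  measurable_fun [set: R] (fun x : R => `|x| `^ s).
Proof.
by apply: (@measurableT_comp _ _ _ _ _ _ (@powR R ^~ s)).
Qed.

Section normal.
Context {R : realType}.
Local Notation mu := (@lebesgue_measure R).
Local Open Scope ereal_scope.

Lemma ge0_integral_normal_prob (m s : R) (f : R -> \bar R) :
  measurable_fun [set: R] f -> (forall x, 0 <= f x) ->
  \int[normal_prob m s]_x f x = \int[mu]_x (f x * (normal_pdf m s x)%:E).
Proof.
move=> mf f0; apply: ge0_integral_density => //.
- exact: measurable_normal_pdf.
- by move=> x; exact: normal_pdf_ge0.
Qed.

Lemma ge0_integral_lebesgue_measureN (f : R -> \bar R) :
  measurable_fun [set: R] f -> (forall x, 0 <= f x) ->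
  \int[mu]_x f (- x)%R = \int[mu]_x f x.
Proof.
move=> mf f0.
have mN : measurable_fun [set: measurableTypeR R]
  (-%R : measurableTypeR R -> measurableTypeR R) by exact: oppr_measurable.
have f0' : {in [set: measurableTypeR R], forall x, 0 <= f x} by move=> x _.
have <- := @ge0_integral_pushforward _ _ (measurableTypeR R) (measurableTypeR R)
  R -%R mN mu setT f measurableT mf f0'.
by apply: eq_measure_integral => A mA _; exact: lebesgue_measureN.
Qed.

Lemma ge0_integral_normal_probN (s : R) (f : R -> \bar R) : s != 0%R ->
  measurable_fun [set: R] f -> (forall x, 0 <= f x) ->
  \int[normal_prob 0 s]_x f (- x)%R = \int[normal_prob 0 s]_x f x.
Proof.
move=> s0 mf f0.
rewrite !ge0_integral_normal_prob//; last exact: measurableT_comp.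
have pdfN x : normal_pdf 0 s (- x) = normal_pdf 0 s x :> R.
  by rewrite !normal_pdfE// /normal_fun !subr0 sqrrN.
have mg : measurable_fun [set: R] (fun x => f x * (normal_pdf 0 s x)%:E).
  apply: emeasurable_funM => //; apply/measurable_EFinP.
  exact: measurable_normal_pdf.
rewrite -(ge0_integral_lebesgue_measureN mg) => [|x]; last first.
  by rewrite mule_ge0// lee_fin normal_pdf_ge0.
by apply: eq_integral => x _; rewrite pdfN.
Qed.

Lemma integral_normal_prob_powR_lty (s : R) : (0 <= s)%R ->
  \int[normal_prob 0 1]_x (`|x| `^ s)%:E < +oo.
Proof.
move=> s0; have [C C0 HC] := powR_norm_le_expR s0.
have mf : measurable_fun [set: R] (fun x : R => (`|x| `^ s)%:E).
  by apply/measurable_EFinP; exact: measurable_powR_norm.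
rewrite ge0_integral_normal_prob//.
(* exp(x^2/4) exp(-x^2/2) = exp(-x^2/4) is proportional to the centred normal density of variance 2;
   [K] corrects the normalisation. *)
pose v : R := Num.sqrt 2; pose K : R := (C * (normal_peak 1 / normal_peak v))%R.
have v0 : v != 0%R by rewrite sqrtr_eq0 -ltNge.
have K0 : (0 <= K)%R by rewrite mulr_ge0 ?divr_ge0 ?normal_peak_ge0.
apply: le_lt_trans (_ : K%:E * \int[mu]_x (normal_pdf 0 v x)%:E < +oo); last first.
  by rewrite integral_normal_pdf mule1 ltry.
rewrite -ge0_integralZl//; last 2 first.
- by apply/measurable_EFinP; exact: measurable_normal_pdf.
- by move=> x _; rewrite lee_fin normal_pdf_ge0.
apply: ge0_le_integral => //.
- by move=> x _; rewrite mule_ge0 ?lee_fin ?powR_ge0 ?normal_pdf_ge0.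
- apply: emeasurable_funM => //; apply/measurable_EFinP.
  exact: measurable_normal_pdf.
- apply: emeasurable_funM => //; apply/measurable_EFinP.
  exact: measurable_normal_pdf.
- move=> x _; rewrite lee_fin !normal_pdfE ?oner_neq0// /K.
  have pv0 := normal_peak_gt0 v0.
  apply: (@le_trans _ _ (C * expR (x ^+ 2 / 4) *
      (normal_peak 1 * normal_fun 0 1 x))%R).
    by rewrite ler_wpM2r ?mulr_ge0 ?normal_peak_ge0 ?normal_fun_ge0.
  have -> : normal_fun 0 v x = (expR (x ^+ 2 / 4) * normal_fun 0 1 x)%R.
    rewrite /normal_fun -expRD !subr0 sqr_sqrtr//; congr expR.
    by field.
  by rewrite le_eqVlt; apply/orP; left; apply/eqP; field; rewrite gt_eqF.
Qed.

End normal.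

(** * Independence, uncorrelated sums and Chebyshev's inequality *)

Section independence.
Context d (T : measurableType d) (R : realType) (P : probability T R).
Local Open Scope ereal_scope.

Lemma mutually_independent_pair (X : nat -> {RV P >-> R}) (i j : nat)
    (A B : set R) :
  mutually_independent X -> i != j -> measurable A -> measurable B ->
  P (X i @^-1` A `&` X j @^-1` B) = P (X i @^-1` A) * P (X j @^-1` B).
Proof.
move=> indX ij mA mB.
have := indX [fset i; j]%fset (fun k => if k == i then A else B).
have mAB (k : nat) : measurable (if k == i then A else B) by case: ifP.
move=> /(_ mAB); rewrite big_fsetU1 ?inE// big_seq_fset1 eqxx eq_sym.
rewrite (negbTE ij) => <-; congr (P _); apply/seteqP; split => [w [Xi Xj] k /=|w H].
  by rewrite !inE => /orP[] /eqP ->; rewrite ?eqxx// eq_sym (negbTE ij).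
split; first by have := H i; rewrite /= !inE eqxx; exact.
by have := H j; rewrite /= !inE eqxx orbT eq_sym (negbTE ij); exact.
Qed.

(** Independence makes the joint law the product of the marginal laws, and Fubini's theorem then
    factors the integral of f(x) g(y). *)
Lemma expectation_independentM (X Y : {RV P >-> R}) (f g : R -> R) :
  (forall A B : set R, measurable A -> measurable B ->
    P (X @^-1` A `&` Y @^-1` B) = P (X @^-1` A) * P (Y @^-1` B)) ->
  measurable_fun [set: R] f -> measurable_fun [set: R] g ->
  (f \o X : T -> R) \in Lfun P 2%:E -> (g \o Y : T -> R) \in Lfun P 2%:E ->
  'E_P[(f \o X) * (g \o Y)] = 'E_P[f \o X] * 'E_P[g \o Y].
Proof.
move=> indXY mf mg fX2 gY2.
have P1 : P setT \is a fin_num by rewrite probability_setT.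
have fX1 := Lfun_subset12 P1 fX2; have gY1 := Lfun_subset12 P1 gY2.
pose Z w := (X w, Y w).
have mZ : measurable_fun [set: T] Z by exact: measurable_fun_pair.
pose h (z : R * R) := (f z.1 * g z.2)%:E.
have mh : measurable_fun [set: R * R] h.
  by apply/measurable_EFinP; apply: measurable_funM; apply: measurableT_comp.
pose Zm : {mfun T >-> (R * R)%type} := HB.pack Z (isMeasurableFun.Build _ _ _ _ _ mZ).
(* A product measure is determined by its values on measurable rectangles. *)
have prodE (S : set (R * R)) : measurable S ->
    (distribution P X \x distribution P Y) S = distribution P Zm S.
  by apply: product_measure_unique => A B mA mB /=; rewrite -indXY.
have hZ : P.-integrable [set: T] (h \o Zm).
  by apply/Lfun1_integrable; exact: Lfun2_mul_Lfun1.
have ih : (distribution P X \x distribution P Y).-integrable [set: R * R] h.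
  apply/integrableP; split => //.
  rewrite (eq_measure_integral (distribution P Zm)); last first.
    by move=> A mA _; exact: prodE.
  rewrite ge0_integral_distribution//; last exact: measurableT_comp.
  by have /integrableP[] := hZ.
have fint : (distribution P X).-integrable [set: R] (EFin \o f).
  apply: integrable_pushforward => //; first exact/measurable_EFinP.
  exact/Lfun1_integrable.
have gint : (distribution P Y).-integrable [set: R] (EFin \o g).
  apply: integrable_pushforward => //; first exact/measurable_EFinP.
  exact/Lfun1_integrable.
rewrite unlock.
transitivity (\int[distribution P Zm]_z h z); first by rewrite integral_distribution.
transitivity (\int[distribution P X \x distribution P Y]_z h z).
  by apply: eq_measure_integral => A mA _; exact/esym/prodE.
have gE : \int[distribution P Y]_y (g y)%:E =
    (fine (\int[distribution P Y]_y (g y)%:E))%:E.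
  by rewrite fineK//; exact: integrable_fin_num.
rewrite -integral12_prod_meas1//= /fubini_F /h /=.
under eq_integral => x _.
  under eq_integral do rewrite EFinM.
  rewrite integralZl// gE; over.
rewrite /= integralZr// -gE.
rewrite (integral_distribution (f := EFin \o f))//; last 2 first.
- exact/measurable_EFinP.
- exact/Lfun1_integrable.
rewrite (integral_distribution (f := EFin \o g))//; last 2 first.
- exact/measurable_EFinP.
- exact/Lfun1_integrable.
Qed.

Lemma covariance_independent (X Y : {RV P >-> R}) (f g : R -> R) :
  (forall A B : set R, measurable A -> measurable B ->
    P (X @^-1` A `&` Y @^-1` B) = P (X @^-1` A) * P (Y @^-1` B)) ->
  measurable_fun [set: R] f -> measurable_fun [set: R] g ->
  (f \o X : T -> R) \in Lfun P 2%:E -> (g \o Y : T -> R) \in Lfun P 2%:E ->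
  covariance P (f \o X) (g \o Y) = 0.
Proof.
move=> indXY mf mg fX2 gY2.
have P1 : P setT \is a fin_num by rewrite probability_setT.
have fX1 := Lfun_subset12 P1 fX2; have gY1 := Lfun_subset12 P1 gY2.
rewrite covarianceE//; last exact: Lfun2_mul_Lfun1.
by rewrite expectation_independentM// subee// fin_numM// expectation_fin_num.
Qed.

Lemma covariance_suml (I : eqType) (s : seq I) (Y : I -> T -> R) (Z : T -> R) :
  (forall i, Y i \in Lfun P 2%:E) -> Z \in Lfun P 2%:E ->
  covariance P (\sum_(i <- s) Y i)%R Z = \sum_(i <- s) covariance P (Y i) Z.
Proof.
move=> Y2 Z2; elim: s => [|i s IH]; first by rewrite !big_nil covariance_cst_l.
by rewrite !big_cons covarianceDl ?IH// rpred_sum// ?lee1n.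
Qed.

Lemma variance_sum (I : eqType) (s : seq I) (Y : I -> T -> R) : uniq s ->
  (forall i, Y i \in Lfun P 2%:E) ->
  (forall i j, i != j -> covariance P (Y i) (Y j) = 0) ->
  'V_P[(\sum_(i <- s) Y i)%R] = \sum_(i <- s) 'V_P[Y i].
Proof.
move=> + Y2 Y0; elim: s => [_|i s IH /= /andP[si us]].
  by rewrite !big_nil variance_cst.
rewrite !big_cons varianceD// ?IH//; last by rewrite rpred_sum// ?lee1n.
have -> : covariance P (Y i) (\sum_(j <- s) Y j)%R = 0.
  rewrite covarianceC covariance_suml// big_seq; apply: big1 => j js.
  by rewrite Y0//; apply: contraNneq si => <-.
by rewrite mule0 adde0.
Qed.

Lemma expectation_sum_fun (I : eqType) (s : seq I) (Y : I -> T -> R) :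
  (forall i, Y i \in Lfun P 1) ->
  'E_P[(\sum_(i <- s) Y i)%R] = \sum_(i <- s) 'E_P[Y i].
Proof.
move=> Y1; rewrite -(big_map Y xpredT idfun) expectation_sum ?big_map//.
by move=> _ /mapP[i _ ->].
Qed.

Lemma chebyshev_sum (I : eqType) (s : seq I) (Y : I -> T -> R) (e : I -> R)
    (V t : R) : uniq s ->
  (forall i, Y i \in Lfun P 2%:E) ->
  (forall i j, i != j -> covariance P (Y i) (Y j) = 0) ->
  (forall i, 'E_P[Y i] = (e i)%:E) ->
  \sum_(i <- s) 'V_P[Y i] <= V%:E -> (0 < t)%R ->
  P [set w | (t <= `|\sum_(i <- s) Y i w - \sum_(i <- s) e i|)%R]
    <= (V / t ^+ 2)%:E.
Proof.
move=> us Y2 Y0 Ye YV t0.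
have P1 : P setT \is a fin_num by rewrite probability_setT.
have S2 : (\sum_(i <- s) Y i)%R \in Lfun P 2%:E by rewrite rpred_sum// ?lee1n.
have mS : measurable_fun [set: T] (\sum_(i <- s) Y i)%R.
  by have := sub_Lfun_mfun S2; rewrite inE.
pose S : {RV P >-> R} := HB.pack (\sum_(i <- s) Y i)%R
  (isMeasurableFun.Build _ _ _ _ _ mS).
have := chebyshev S t0.
rewrite /S/= expectation_sum_fun => [|i]; last exact: Lfun_subset12 P1 _ (Y2 i).
rewrite (eq_bigr (fun i => (e i)%:E)) => [|i _]; last exact: Ye.
rewrite sumEFin/= variance_sum//.
under eq_set do rewrite fct_sumE.
move=> /le_trans; apply; rewrite mulrC EFinM.
by apply: lee_wpmul2l => //; rewrite lee_fin invr_ge0 sqr_ge0.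
Qed.

End independence.

(** * Integrals of nonnegative real-valued functions *)

Lemma ge0_le_integral_EFin d (T : measurableType d) (R : realType)
    (mu : {measure set T -> \bar R}) (f g : T -> R) :
  measurable_fun [set: T] f -> measurable_fun [set: T] g ->
  (forall x, 0 <= f x) -> (forall x, f x <= g x) ->
  (\int[mu]_x (f x)%:E <= \int[mu]_x (g x)%:E)%E.
Proof.
move=> /measurable_EFinP mf /measurable_EFinP mg f0 fg.
by apply: ge0_le_integral => // x _; rewrite lee_fin.
Qed.

Lemma ge0_integralD_EFin d (T : measurableType d) (R : realType)
    (mu : {measure set T -> \bar R}) (f g : T -> R) :
  measurable_fun [set: T] f -> measurable_fun [set: T] g ->
  (forall x, 0 <= f x) -> (forall x, 0 <= g x) ->
  (\int[mu]_x (f x + g x)%:E =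
   \int[mu]_x (f x)%:E + \int[mu]_x (g x)%:E)%E.
Proof.
move=> /measurable_EFinP mf /measurable_EFinP mg f0 g0.
under eq_integral do rewrite EFinD.
by rewrite ge0_integralD// => x _; rewrite lee_fin.
Qed.

Lemma ge0_integral_affine d (T : measurableType d) (R : realType)
    (P : probability T R) (f g : T -> R) (a b c mf mg : R) :
  measurable_fun [set: T] f -> measurable_fun [set: T] g ->
  (forall x, 0 <= f x) -> (forall x, 0 <= g x) ->
  0 <= a -> 0 <= b -> 0 <= c ->
  (\int[P]_x (f x)%:E = mf%:E)%E -> (\int[P]_x (g x)%:E = mg%:E)%E ->
  (\int[P]_x (a + b * f x + c * g x)%:E = (a + b * mf + c * mg)%:E)%E.
Proof.
move=> /measurable_EFinP mef /measurable_EFinP meg f0 g0 a0 b0 c0 fE gE.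
have bf0 x : (0 <= b%:E * (f x)%:E)%E by rewrite mule_ge0 ?lee_fin.
have cg0 x : (0 <= c%:E * (g x)%:E)%E by rewrite mule_ge0 ?lee_fin.
have mbf : measurable_fun [set: T] (fun x => b%:E * (f x)%:E)%E.
  exact: emeasurable_funM.
have mcg : measurable_fun [set: T] (fun x => c%:E * (g x)%:E)%E.
  exact: emeasurable_funM.
under eq_integral do rewrite 2!EFinD 2!EFinM.
rewrite ge0_integralD//; last 2 first.
- by move=> x _; apply: adde_ge0; rewrite ?lee_fin//; exact: bf0.
- exact: emeasurable_funD.
rewrite ge0_integralD// !ge0_integralZl//.
rewrite integral_cst//= ?fE ?gE ?probability_setT.
- by rewrite mule1 !EFinD !EFinM.
- by move=> x _; rewrite lee_fin.
- by move=> x _; rewrite lee_fin.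
Qed.

(** If the integral were 0, then f would vanish off a null set, and the whole space would be covered
    by two null sets. *)
Lemma ge0_integral_gt0 d (T : measurableType d) (R : realType)
    (mu : {measure set T -> \bar R}) (f : T -> R) :
  measurable_fun [set: T] f -> (forall x, 0 <= f x) ->
  (0 < mu [set: T])%E -> mu [set x | f x = 0] = 0%E ->
  (0 < \int[mu]_x (f x)%:E)%E.
Proof.
move=> mf f0 muT muf0.
rewrite lt_neqAle integral_ge0 ?andbT => [|x _]; last by rewrite lee_fin.
apply/negP => /eqP /esym I0.
have mfE : measurable_fun [set: T] (EFin \o f) by exact/measurable_EFinP.
have aI0 : (\int[mu]_x `| (EFin \o f) x | = 0)%E.
  by rewrite -I0; apply: eq_integral => x _; rewrite gee0_abs ?lee_fin.
have [A [mA muA0 fA]] := (ae_eq_integral_abs mu measurableT mfE).1 aI0.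
have : (mu [set: T] <= mu [set x | f x = 0%R] + mu A)%E.
  have mZ : measurable [set x | f x = 0%R].
    by rewrite -[X in measurable X]setTI; exact: (mf measurableT _ (measurable_set1 0)).
  apply: (@le_trans _ _ (mu ([set x | f x = 0%R] `|` A))).
    apply: le_measure; rewrite ?inE//; first exact: measurableU.
    move=> x _; have [fx|fx] := pselect (f x = 0%R); first by left.
    by right; apply: fA => /= /(_ I) [].
  by apply: measureU2.
by rewrite muf0 muA0 add0e leNgt muT.
Qed.

(** * Moments of the standard normal law and of its shifts *)

Section normal_moments.
Context {R : realType}.
Local Open Scope ereal_scope.
Local Notation N := (@normal_prob R 0 1).

Lemma measurable_affine_powR_norm (a b c s t : R) :
  measurable_fun [set: R] (fun x : R => a + b * `|x| `^ s + c * `|x| `^ t)%R.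
Proof.
apply: measurable_funD; last first.
  by apply: measurable_funM => //; exact: measurable_powR_norm.
apply: measurable_funD => //.
by apply: measurable_funM => //; exact: measurable_powR_norm.
Qed.

(** A real number, so that moment bounds become real arithmetic; for [0 <= s] the integral is finite
    and [fine] is faithful. *)
Definition normal_moment (s : R) : R := fine (\int[N]_x (`|x| `^ s)%:E).

Lemma normal_momentE (s : R) : (0 <= s)%R ->
  \int[N]_x (`|x| `^ s)%:E = (normal_moment s)%:E.
Proof.
move=> s0; rewrite fineK// ge0_fin_numE ?integral_normal_prob_powR_lty//.
by apply: integral_ge0 => x _; rewrite lee_fin powR_ge0.
Qed.

Lemma normal_moment_ge0 (s : R) : (0 <= normal_moment s)%R.
Proof.
by apply: fine_ge0; apply: integral_ge0 => x _; rewrite lee_fin powR_ge0.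
Qed.

Lemma normal_prob_countable (A : set R) : countable A -> N A = 0.
Proof.
move=> cA; have := @normal_prob_dominates R 0 1.
move=> /null_content_dominatesP; apply; last exact: countable_lebesgue_measure0.
by apply: countable_measurable => // t; exact: measurable_set1.
Qed.

Lemma integral_normal_prob_gt0 (f : R -> R) :
  measurable_fun [set: R] f -> (forall x, (0 <= f x)%R) ->
  countable [set x | f x = 0%R] -> 0 < \int[N]_x (f x)%:E.
Proof.
move=> mf f0 cf; apply: ge0_integral_gt0 => //.
- by rewrite [ltRHS](_ : _ = 1) ?lte01//; exact: integral_normal_pdf.
- exact: normal_prob_countable.
Qed.

Lemma normal_moment_gt0 (s : R) : (0 < s)%R -> (0 < normal_moment s)%R.
Proof.
move=> s0; rewrite -lte_fin -normal_momentE ?ltW//.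
apply: integral_normal_prob_gt0.
- exact: measurable_powR_norm.
- by move=> x; exact: powR_ge0.
- apply: (@sub_countable _ _ _ [set 0%R]); last exact: countable1.
  by apply: subset_card_le => x /= /powR_eq0_eq0/normr0_eq0 ->.
Qed.

Lemma integral_normal_prob_affine (a b c s t : R) :
  (0 <= a)%R -> (0 <= b)%R -> (0 <= c)%R -> (0 <= s)%R -> (0 <= t)%R ->
  \int[N]_x (a + b * `|x| `^ s + c * `|x| `^ t)%:E =
  (a + b * normal_moment s + c * normal_moment t)%:E.
Proof.
move=> a0 b0 c0 s0 t0.
apply: ge0_integral_affine => //.
- exact: measurable_powR_norm.
- exact: measurable_powR_norm.
- exact: normal_momentE.
- exact: normal_momentE.
Qed.

Lemma integral_normal_shift_powR_lty (p x : R) : (0 <= p)%R ->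
  \int[N]_e (`|x + e| `^ p)%:E < +oo.
Proof.
move=> p0.
have K0 : (0 <= 2 `^ p)%R by exact: powR_ge0.
have a0 : (0 <= 2 `^ p * `|x| `^ p)%R by rewrite mulr_ge0 ?powR_ge0.
have mf : measurable_fun [set: R] (fun e : R => `|x + e| `^ p)%R.
  by apply: (measurableT_comp (measurable_powR_norm p)); exact: measurable_funD.
(* The zero summand pads the bound to the three-term shape of [integral_normal_prob_affine]. *)
apply: le_lt_trans (ltry (2 `^ p * `|x| `^ p + 2 `^ p * normal_moment p
  + 0 * normal_moment 0)%R).
rewrite -integral_normal_prob_affine//.
apply: ge0_le_integral_EFin => //.
- exact: measurable_affine_powR_norm.
- move=> e; rewrite mul0r addr0 -mulrDr.
  apply: (le_trans _ (powR_add_le p0 (normr_ge0 x) (normr_ge0 e))).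
  by apply: ler_powR2r => //; exact: ler_normD.
Qed.

Definition normal_shift_moment (p x : R) : R :=
  fine (\int[N]_e (`|x + e| `^ p)%:E).

Lemma normal_shift_momentE (p x : R) : (0 <= p)%R ->
  \int[N]_e (`|x + e| `^ p)%:E = (normal_shift_moment p x)%:E.
Proof.
move=> p0; rewrite fineK// ge0_fin_numE ?integral_normal_shift_powR_lty//.
by apply: integral_ge0 => e _; rewrite lee_fin powR_ge0.
Qed.

(* The law of [e] is symmetric, so the mean of [`|x + e| `^ p] is also that of
   the average of [`|x + e| `^ p] and [`|x - e| `^ p]. *)
Lemma normal_shift_moment_ge (p x : R) : (2 < p)%R ->
  (2 * normal_moment p + `|x| `^ p +
   p / 2 * x ^+ 2 * normal_moment (p - 2) <= 2 * normal_shift_moment p x)%R.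
Proof.
move=> p2; have p0 : (0 <= p)%R by lra.
have mS : measurable_fun [set: R] (fun e : R => `|x + e| `^ p)%R.
  by apply: (measurableT_comp (measurable_powR_norm p)); exact: measurable_funD.
have mS' : measurable_fun [set: R] (fun e : R => `|x - e| `^ p)%R.
  by apply: (measurableT_comp (measurable_powR_norm p)); exact: measurable_funB.
have S0 (e : R) : (0 <= `|x + e| `^ p)%R by exact: powR_ge0.
have S0' (e : R) : (0 <= `|x - e| `^ p)%R by exact: powR_ge0.
have SE := normal_shift_momentE x p0.
have SE' : \int[N]_e (`|x - e| `^ p)%:E = (normal_shift_moment p x)%:E.
  have mSE : measurable_fun [set: R] (fun e : R => (`|x + e| `^ p)%:E).
    exact/measurable_EFinP.
  exact: etrans (ge0_integral_normal_probN (oner_neq0 R) mSE S0) SE.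
have sumE : \int[N]_e (`|x + e| `^ p + `|x - e| `^ p)%:E =
    (normal_shift_moment p x + normal_shift_moment p x)%:E.
  rewrite EFinD -[X in _ = X + _]SE -[X in _ = _ + X]SE'.
  by apply: ge0_integralD_EFin.
have c0 : (0 <= p / 2 * x ^+ 2)%R by rewrite mulr_ge0 ?sqr_ge0//; lra.
have p20 : (0 <= p - 2)%R by lra.
have affE := integral_normal_prob_affine
  (powR_ge0 `|x| p) (ler0n R 2) c0 p0 p20.
have : \int[N]_e (`|x| `^ p + 2 * `|e| `^ p + p / 2 * x ^+ 2 * `|e| `^ (p - 2))%:E
    <= \int[N]_e (`|x + e| `^ p + `|x - e| `^ p)%:E.
  apply: ge0_le_integral_EFin.
  - exact: measurable_affine_powR_norm.
  - exact: measurable_funD.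
  - by move=> e; rewrite addr_ge0 ?(mulr_ge0 c0)// addr_ge0 ?mulr_ge0 ?powR_ge0.
  - by move=> e; have := powR_norm_symmetrized x e p2; lra.
rewrite sumE affE lee_fin; lra.
Qed.

End normal_moments.

(** * Mean and variance of powers of a shifted standard normal variable *)

Lemma Lfun2_integral_sqr_lty d (T : measurableType d) (R : realType)
    (mu : {measure set T -> \bar R}) (f : T -> R) :
  measurable_fun [set: T] f -> (\int[mu]_x (f x ^+ 2)%:E < +oo)%E ->
  f \in Lfun mu 2%:E.
Proof.
move=> mf f2; rewrite inE; apply/andP; split; rewrite inE//=.
rewrite /finite_norm unlock poweR_lty//.
rewrite (eq_integral (fun x => (f x ^+ 2)%:E))// => x _.
by rewrite /= powR_mulrn// real_normK// num_real.
Qed.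

Section standard_normal_powers.
Context d (T : measurableType d) (R : realType) (P : probability T R).
Variables (X : {RV P >-> R}) (hX : standard_normal X).
Local Open Scope ereal_scope.
Local Notation N := (@normal_prob R 0 1).

Lemma ge0_expectation_standard_normal (f : R -> R) :
  measurable_fun [set: R] f -> (forall x, (0 <= f x)%R) ->
  'E_P[f \o X] = \int[N]_x (f x)%:E.
Proof.
move=> mf f0; rewrite unlock.
have mX : measurable_fun [set: T] (X : T -> measurableTypeR R).
  exact: (measurable_funPT X).
pose X' : {mfun T >-> measurableTypeR R} :=
  HB.pack (X : T -> measurableTypeR R) (isMeasurableFun.Build _ _ _ _ _ mX).
have mfE : measurable_fun [set: measurableTypeR R] (EFin \o f).
  exact/measurable_EFinP.
transitivity (\int[distribution P X']_x (EFin \o f) x).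
  by rewrite ge0_integral_distribution// => x; rewrite lee_fin.
by apply: eq_measure_integral => A mA _; exact: hX.
Qed.

Lemma measurable_shift_powR (p x : R) :
  measurable_fun [set: R] (fun e : R => `|x + e| `^ p)%R.
Proof.
by apply: (measurableT_comp (measurable_powR_norm p)); exact: measurable_funD.
Qed.

Lemma Lfun2_shift_powR (p x : R) : (0 <= p)%R ->
  (fun w => `|x + X w| `^ p)%R \in Lfun P 2%:E.
Proof.
move=> p0; apply: Lfun2_integral_sqr_lty.
  exact: (measurableT_comp (measurable_shift_powR p x)).
pose f (e : R) := (`|x + e| `^ (2 * p))%R.
have p20 : (0 <= 2 * p)%R by rewrite mulr_ge0.
apply: le_lt_trans (integral_normal_shift_powR_lty x p20).
have fX := @ge0_expectation_standard_normal f (measurable_shift_powR _ _)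
  (fun=> powR_ge0 _ _).
rewrite -[leRHS]fX unlock.
rewrite (eq_integral (fun w => (f (X w))%:E))// => w _.
by rewrite -powR_mulrn ?powR_ge0// -powRrM mulrC.
Qed.

Lemma expectation_shift_powR (p x : R) : (0 <= p)%R ->
  'E_P[(fun w => `|x + X w| `^ p)%R] = (normal_shift_moment p x)%:E.
Proof.
move=> p0; rewrite -(normal_shift_momentE x p0).
apply: (@ge0_expectation_standard_normal (fun e => `|x + e| `^ p)%R) => //.
exact: measurable_shift_powR.
Qed.

(** The variance is at most the second moment about any constant; the constant |x|^p is the one for
    which [powR_norm_shift_sqr_le] bounds the integrand. *)
Lemma variance_shift_powR_le (p x : R) : (1 < p)%R ->
  'V_P[(fun w => `|x + X w| `^ p)%R] <=
  (p ^+ 2 * 2 `^ (2 * p - 2) * (`|x| `^ (2 * p - 2) * normal_moment 2 +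
     normal_moment (2 * p)))%:E.
Proof.
move=> p1; have p0 : (0 <= p)%R by lra.
set K := (p ^+ 2 * 2 `^ (2 * p - 2))%R.
have K0 : (0 <= K)%R by rewrite mulr_ge0 ?powR_ge0 ?sqr_ge0.
have Y2 := Lfun2_shift_powR x p0.
pose c := (`|x| `^ p)%R.
have mS : measurable_fun [set: R] (fun e : R => (`|x + e| `^ p - c) ^+ 2)%R.
  apply: measurable_funX; apply: measurable_funB => //.
  exact: measurable_shift_powR.
have Yc2 : ((fun w => `|x + X w| `^ p) \- cst c)%R \in Lfun P 2%:E.
  by rewrite rpredB//= ?lee1n// Lfun_cst.
rewrite -(varianceB_cst_r c)// varianceE//.
apply: (@le_trans _ _ 'E_P[(((fun w => `|x + X w| `^ p) \- cst c) ^+ 2)%R]).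
  have P1 : P setT \is a fin_num by rewrite probability_setT.
  rewrite -['E_P[_ \- _]%R]fineK; last first.
    exact: expectation_fin_num (Lfun_subset12 P1 Yc2).
  by rewrite -EFin_expe leeBlDr// leeDl// lee_fin sqr_ge0.
rewrite (@ge0_expectation_standard_normal
  (fun e => (`|x + e| `^ p - c) ^+ 2)%R)//; last by move=> e; exact: sqr_ge0.
have -> : (K * (`|x| `^ (2 * p - 2) * normal_moment 2 + normal_moment (2 * p)) =
  0 + K * `|x| `^ (2 * p - 2) * normal_moment 2 + K * normal_moment (2 * p))%R.
  by ring.
rewrite -integral_normal_prob_affine ?mulr_ge0 ?powR_ge0//.
apply: ge0_le_integral_EFin => //.
- exact: measurable_affine_powR_norm.
- by move=> e; exact: sqr_ge0.
- by move=> e; rewrite add0r -mulrA -mulrDr; exact: powR_norm_shift_sqr_le.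
Qed.

Lemma mu_abs_standard_normal (p : R) : (0 <= p)%R -> mu_abs X p = normal_moment p.
Proof.
move=> p0; rewrite /mu_abs.
rewrite (@ge0_expectation_standard_normal (fun e => `|e| `^ p)%R)//.
exact: measurable_powR_norm.
Qed.

Lemma variance_powR_standard_normal (p : R) : (0 <= p)%R ->
  'V_P[(fun w => `|X w| `^ p)%R] =
  (normal_moment (2 * p) - normal_moment p ^+ 2)%:E.
Proof.
move=> p0; have Y2 : (fun w => `|X w| `^ p)%R \in Lfun P 2%:E.
  have -> : (fun w => `|X w| `^ p)%R = (fun w => `|0 + X w| `^ p)%R; last first.
    exact: Lfun2_shift_powR.
  by apply/funext => w; rewrite add0r.
rewrite varianceE// (@ge0_expectation_standard_normal (fun e => `|e| `^ p)%R)//;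
  last exact: measurable_powR_norm.
have -> : ((fun w => `|X w| `^ p) ^+ 2 = (fun e => `|e| `^ (2 * p)) \o X)%R.
  apply/funext => w; rewrite /= [RHS]powRrM [RHS]powRAC powR_mulrn ?powR_ge0//.
rewrite ge0_expectation_standard_normal//; last exact: measurable_powR_norm.
by rewrite !normal_momentE ?mulr_ge0// -EFin_expe.
Qed.

(** The squared deviation of |e|^p from its mean m vanishes only where |e| = m^(1/p), at no more
    than two points, which the normal law does not charge. This makes the margin in the threshold
    positive. *)
Lemma sigma2_abs_gt0 (p : R) : (0 < p)%R -> (0 < sigma2_abs X p)%R.
Proof.
move=> p0; have Y2 : (fun w => `|X w| `^ p)%R \in Lfun P 2%:E.
  have -> : (fun w => `|X w| `^ p)%R = (fun w => `|0 + X w| `^ p)%R; last first.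
    exact: Lfun2_shift_powR (ltW p0).
  by apply/funext => w; rewrite add0r.
rewrite /sigma2_abs -lte_fin fineK ?variance_fin_num//.
rewrite /variance unlock.
set m := fine _; pose h (e : R) := ((`|e| `^ p - m) * (`|e| `^ p - m))%R.
have mh : measurable_fun [set: R] h.
  by apply: measurable_funM; apply: measurable_funB => //; exact: measurable_powR_norm.
have h0 e : (0 <= h e)%R by rewrite /h -expr2 sqr_ge0.
rewrite [ltRHS](ge0_expectation_standard_normal mh h0).
apply: integral_normal_prob_gt0 => //.
pose a := (m `^ p^-1)%R.
apply: (@sub_countable _ _ _ [set a; - a]%R); last first.
  by apply: finite_set_countable; rewrite finite_setU; split; exact: finite_set1.
apply: subset_card_le => e /= /eqP; rewrite mulf_eq0 orbb subr_eq0 => /eqP em.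
have : (`|e| = a)%R.
  by rewrite /a -em -powRrM mulfV ?gt_eqF// powRr1.
by case: (ger0P e) => _ <-; [left|right; rewrite opprK].
Qed.

End standard_normal_powers.

(** * The energy of an alternative *)

Section energy.
Context {R : realType}.
Implicit Types (d n : nat) (p q r rho : R).

Lemma powRD_gt0 (x r s : R) : 0 < x -> x `^ (r + s) = x `^ r * x `^ s.
Proof. by move=> x0; rewrite powRD// (gt_eqF x0) implybT. Qed.

(** Jensen's inequality: sum the tangent bounds at the mean [c], where the linear terms add up to 0.
    The case m = 1, needed for q = 2, is an equality treated apart. *)
Lemma powR_mean_le n (a : 'I_n -> R) (m : R) : (0 < n)%N -> 1 <= m ->
  (forall i, 0 <= a i) ->
  n%:R * ((\sum_i a i) / n%:R) `^ m <= \sum_i a i `^ m.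
Proof.
move=> n0; have nR : 0 < n%:R :> R by rewrite ltr0n.
rewrite le_eqVlt => /predU1P[<- a0|m1 a0].
  have s0 : 0 <= \sum_i a i by rewrite sumr_ge0.
  rewrite powRr1 ?divr_ge0// mulrC divfK ?gt_eqF//.
  by apply: ler_sum => i _; rewrite powRr1.
have s0 : 0 <= (\sum_i a i) / n%:R by rewrite divr_ge0 ?sumr_ge0.
set c := _ / _ in s0 *.
have -> : n%:R * c `^ m = \sum_i (c `^ m + m * c `^ (m - 1) * (a i - c)).
  rewrite big_split/= -mulr_sumr sumrB !sumr_const card_ord.
  by rewrite -(mulr_natr c) divfK ?gt_eqF// subrr mulr0 addr0 mulr_natl.
by apply: ler_sum => i _; exact: powR_tangent.
Qed.

(* A common lower bound for [energy] over all [q] replaces the union over [q] of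
   the alternatives. *)
Definition energy d p (theta : 'rV[R]_d) : R :=
  \sum_i (theta 0 i ^+ 2 + `|theta 0 i| `^ p).

Lemma powR_le_sum_lq_norm d q r (theta : 'rV[R]_d) : 0 < q -> 0 <= r ->
  r <= lq_norm q theta -> r `^ q <= \sum_i `|theta 0 i| `^ q.
Proof.
move=> q0 r0 rle; have S0 : 0 <= \sum_i `|theta 0 i| `^ q.
  by apply: sumr_ge0 => i _; exact: powR_ge0.
apply: le_trans (ler_powR2r (ltW q0) r0 rle) _.
by rewrite /lq_norm -powRrM mulVf ?gt_eqF// powRr1.
Qed.

(** The critical radii are tuned so that every q gives the same order sqrt d. For q <= 2, the power
    mean inequality with exponent 2/q bounds the sum of squares below by d (rho^q d^(-q/4))^(2/q) =
    rho^2 d^(1/2). For q > 2, the critical radius to the power q is sqrt d, and rho^q >= rho^2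
    because rho >= 1. *)
Lemma energy_alternative_ge d p q r rho (theta : 'rV[R]_d) : (0 < d)%N ->
  2 < p -> 0 < q <= p -> 1 <= rho -> rho * critical_radius q d <= r ->
  alternative q r theta -> rho ^+ 2 * Num.sqrt d%:R <= energy p theta.
Proof.
move=> d0 p2 /andP[q0 qp] rho1 rle thetar.
have dR : 0 < d%:R :> R by rewrite ltr0n.
have rho0 : 0 < rho by lra.
have cr0 : 0 <= critical_radius q d by rewrite /critical_radius; case: ifP => _; exact: powR_ge0.
have := powR_le_sum_lq_norm q0 (mulr_ge0 (ltW rho0) cr0) (le_trans rle thetar).
rewrite powRM ?(ltW rho0)// /critical_radius -powR12_sqrt ?(ltW dR)//.
set S := \sum_i _.
have [q2|q2] := leP q 2; rewrite /= -powRrM => HS.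
  apply: (@le_trans _ _ (\sum_i theta 0 i ^+ 2)); last first.
    by apply: ler_sum => i _; rewrite lerDl powR_ge0.
  have m1 : 1 <= 2 / q by rewrite ler_pdivlMr// mul1r.
  apply: le_trans (le_trans (powR_mean_le (a := fun i => `|theta 0 i| `^ q)
    d0 m1 (fun=> powR_ge0 _ _)) _); last first.
    apply: ler_sum => i _; rewrite -powRrM mulrC divfK ?gt_eqF//.
    by rewrite powR_mulrn// real_normK// num_real.
  have E1 : rho `^ q * d%:R `^ (- (q / 4)) <= S / d%:R.
    rewrite ler_pdivlMr// (le_trans _ HS)// -mulrA ler_wpM2l ?powR_ge0//.
    rewrite -[X in _ * X](powRr1 (ltW dR)) -powRD_gt0//.
    rewrite (_ : - (q / 4) + 1 = (4 - q) / (4 * q) * q)//.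
    by field; rewrite gt_eqF.
  have E0 : 0 <= rho `^ q * d%:R `^ (- (q / 4)) by rewrite mulr_ge0 ?powR_ge0.
  have m0 : 0 <= 2 / q by lra.
  apply: le_trans (ler_wpM2l (ltW dR) (ler_powR2r m0 E0 E1)).
  rewrite powRM ?powR_ge0// -!powRrM mulrCA (mulrC q) divfK ?gt_eqF//.
  rewrite powR_mulrn ?(ltW rho0)// ler_wpM2l ?sqr_ge0//.
  rewrite -[X in X * _](powRr1 (ltW dR)) -powRD_gt0//.
  by rewrite (_ : 1 + - (q / 4) * (2 / q) = 2^-1)//; field; rewrite gt_eqF.
apply: (@le_trans _ _ S); last first.
  by apply: ler_sum => i _; rewrite -real_normK ?num_real// powR_le_add2// ltW.
apply: le_trans HS; rewrite (_ : (2 * q)^-1 * q = 2^-1).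
  by rewrite ler_wpM2r ?powR_ge0// -powR_mulrn ?(ltW rho0)// ler_powR// ltW.
by field; rewrite gt_eqF.
Qed.

(** Split 2p - 2 as p + (p - 2). The factor |x|^(p-2) = (|x|^p)^((p-2)/p) is at most A^((p-2)/p) for
    each coordinate x, and the remaining |x|^p sum to at most A. *)
Lemma sum_powR_le_energy d p (theta : 'rV[R]_d) : 2 < p ->
  \sum_i `|theta 0 i| `^ (2 * p - 2) <= energy p theta `^ (2 - 2 / p).
Proof.
move=> p2; have p0 : 0 < p by lra.
set A := energy p theta.
have t0 (i : 'I_d) : 0 <= theta 0 i ^+ 2 + `|theta 0 i| `^ p.
  by rewrite addr_ge0 ?sqr_ge0 ?powR_ge0.
have A0 : 0 <= A by apply: sumr_ge0 => i _; exact: t0.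
have tA (i : 'I_d) : `|theta 0 i| `^ p <= A.
  rewrite /A /energy (bigD1 i)//= -addrA ler_wpDl ?sqr_ge0// lerDl.
  by apply: sumr_ge0 => j _; exact: t0.
have -> : 2 - 2 / p = 1 + (p - 2) / p by field; rewrite gt_eqF.
have pp0 : 0 < (p - 2) / p by rewrite divr_gt0//; lra.
rewrite powRD; last by rewrite gt_eqF//; lra.
rewrite powRr1// /A /energy mulr_suml; apply: ler_sum => i _.
have -> : 2 * p - 2 = p + p * ((p - 2) / p) by field; rewrite gt_eqF.
rewrite powRD; last by rewrite gt_eqF// addr_gt0// mulr_gt0.
rewrite powRrM; apply: ler_pM; rewrite ?powR_ge0// ?ler_wpDl ?sqr_ge0//.
by apply: ler_powR2r; rewrite ?powR_ge0 ?(ltW pp0)//; exact: tA.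
Qed.

(** Each summand is at most A^2 rho^(-4/p): the first because A >= rho^2, the second because D <=
    A^2 rho^(-4) and 4/p <= 4. *)
Lemma energy_noise_ratio_le (p rho A D : R) : 2 < p -> 1 <= rho -> 1 <= D ->
  rho ^+ 2 * Num.sqrt D <= A ->
  A `^ (2 - 2 / p) + D <= 2 * A ^+ 2 * rho `^ (- (4 / p)).
Proof.
move=> p2 rho1 D1 HA.
have rho0 : 0 < rho by lra.
have sD1 : 1 <= Num.sqrt D by rewrite -sqrtr1 ler_wsqrtr.
have r2 : 0 < rho ^+ 2 by rewrite exprn_gt0.
have Ar : rho ^+ 2 <= A by rewrite (le_trans _ HA)// ler_peMr// ltW.
have A0 : 0 < A by lra.
have p0 : 0 < p by lra.
have P1 : A `^ (2 - 2 / p) <= A ^+ 2 * rho `^ (- (4 / p)).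
  rewrite powRD_gt0//.
  rewrite powR_mulrn ?(ltW A0)// ler_wpM2l ?sqr_ge0//.
  rewrite !powRN lef_pV2 ?posrE ?powR_gt0//.
  have -> : 4 / p = 2%:R * (2 / p) by field; rewrite gt_eqF.
  rewrite powRrM powR_mulrn ?(ltW rho0)//.
  by apply: ler_powR2r => //; [rewrite divr_ge0 ?(ltW p0)|exact: ltW].
have P2 : D <= A ^+ 2 * rho `^ (- (4 / p)).
  have D0 : 0 <= D by lra.
  have : (rho ^+ 2 * Num.sqrt D) ^+ 2 <= A ^+ 2.
    by rewrite ler_sqr ?nnegrE ?mulr_ge0 ?sqrtr_ge0// ltW.
  rewrite exprMn sqr_sqrtr// => H.
  have : rho `^ (4 / p) <= (rho ^+ 2) ^+ 2.
    rewrite -exprM -powR_mulrn ?(ltW rho0)//; apply: ler_powR => //.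
    by rewrite ler_pdivrMr// natrM; lra.
  move=> H2; rewrite powRN ler_pdivlMr ?powR_gt0// (le_trans _ H)//.
  by rewrite mulrC ler_wpM2r.
lra.
Qed.

End energy.

(** * The two error probabilities of the test *)

Section power_test.
Context d0 (T : measurableType d0) (R : realType) (P : probability T R).
Variables (eps : nat -> {RV P >-> R}) (p : R).
Hypotheses (heps : iid_standard_normal eps) (hp : 2 < p).

Let p0 : 0 <= p. Proof. by have := hp; lra. Qed.

Lemma lq_norm_shift d (theta : 'rV[R]_d) w : lq_norm p (theta + noise eps d w) =
  (\sum_i `|theta 0 i + eps i w| `^ p) `^ p^-1.
Proof.
by rewrite /lq_norm; congr (_ `^ _); apply: eq_bigr => i _; rewrite !mxE.
Qed.

Lemma measurable_sum_shift_powR d (theta : 'rV[R]_d) :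
  measurable_fun [set: T] (fun w => \sum_i `|theta 0 i + eps i w| `^ p).
Proof.
apply: measurable_sum => i.
exact: (measurableT_comp (measurable_shift_powR p (theta 0 i))).
Qed.

Lemma measurable_rejects d (c : R) (theta : 'rV[R]_d) :
  measurable (rejects eps p c theta).
Proof.
have mf : measurable_fun [set: T] (fun w => lq_norm p (theta + noise eps d w)).
  rewrite (_ : (fun _ => _) = (fun x => x `^ p^-1) \o
    (fun w => \sum_i `|theta 0 i + eps i w| `^ p)); last first.
    by apply/funext => w; rewrite lq_norm_shift.
  apply: (measurableT_comp (measurable_powR _)).
  exact: measurable_sum_shift_powR.
have := mf measurableT _ (measurable_itv `[c, +oo[).
rewrite setTI; congr measurable; apply/seteqP; split => w /=;
  by rewrite in_itv/= andbT.
Qed.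

Lemma chebyshev_shift d (theta : 'rV[R]_d) (V t : R) :
  (\sum_(i < d) 'V_P[fun w => `|theta 0 i + eps i w| `^ p]%R <= V%:E)%E ->
  0 < t ->
  (P [set w | (t <= `|\sum_i `|theta 0 i + eps i w| `^ p -
      \sum_i normal_shift_moment p (theta 0 i)|)%R] <= (V / t ^+ 2)%:E)%E.
Proof.
move=> HV t0; have [ind std] := heps.
apply: (@chebyshev_sum _ _ _ P 'I_d (index_enum _)
  (fun i w => `|theta 0 i + eps i w| `^ p)) => //.
- exact: index_enum_uniq.
- by move=> i; exact: Lfun2_shift_powR.
- move=> i j ij.
  apply: (@covariance_independent _ _ _ P (eps i) (eps j)
    (fun e => `|theta 0 i + e| `^ p) (fun e => `|theta 0 j + e| `^ p)).
  + by move=> A B mA mB; exact: mutually_independent_pair.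
  + exact: measurable_shift_powR.
  + exact: measurable_shift_powR.
  + exact: Lfun2_shift_powR.
  + exact: Lfun2_shift_powR.
- by move=> i; exact: expectation_shift_powR.
Qed.

Lemma measurable_deviation d (theta : 'rV[R]_d) (t c : R) :
  measurable [set w | (t <= `|\sum_i `|theta 0 i + eps i w| `^ p - c|)%R].
Proof.
have mf : measurable_fun [set: T]
    (fun w => `|\sum_i `|theta 0 i + eps i w| `^ p - c|).
  apply: measurableT_comp => //; apply: measurable_funB => //.
  exact: measurable_sum_shift_powR.
have := mf measurableT _ (measurable_itv `[t, +oo[).
rewrite setTI; congr measurable; apply/seteqP; split => w /=;
  by rewrite in_itv/= andbT.
Qed.

Let mu := mu_abs (eps 0%N) p.
Let s2 := sigma2_abs (eps 0%N) p.

Let s2_gt0 : 0 < s2.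
Proof. by apply: sigma2_abs_gt0; [exact: heps.2|have := hp; lra]. Qed.

Let muE : mu = normal_moment p.
Proof. by apply: mu_abs_standard_normal => //; exact: heps.2. Qed.

Let variance_eps i : ('V_P[fun w => `|eps i w| `^ p]%R = s2%:E)%E.
Proof.
rewrite variance_powR_standard_normal//; last exact: heps.2.
rewrite /s2 /sigma2_abs variance_powR_standard_normal//; last exact: heps.2.
Qed.

Lemma type1_error_le d (rho : R) : (0 < d)%N -> 0 < rho ->
  (P (rejects eps p ((rho * Num.sqrt (d%:R * s2) + d%:R * mu) `^ p^-1)
     (0 : 'rV[R]_d)) <= (rho ^- 2)%:E)%E.
Proof.
move=> d0' rho0; have dR : 0 < d%:R :> R by rewrite ltr0n.
have ds0 : 0 < d%:R * s2 by rewrite mulr_gt0.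
pose t := rho * Num.sqrt (d%:R * s2).
have t0 : 0 < t by rewrite mulr_gt0 ?sqrtr_gt0.
have mu0 : 0 <= mu by rewrite muE normal_moment_ge0.
have VE : (\sum_(i < d) 'V_P[fun w => `|(0 : 'rV[R]_d) ord0 i + eps i w| `^ p]%R
    <= (d%:R * s2)%:E)%E.
  rewrite (eq_bigr (fun=> s2%:E)) => [|i _].
    by rewrite sumEFin sumr_const card_ord mulr_natl.
  rewrite -(variance_eps i); congr ('V_P[_])%E; apply/funext => w.
  by rewrite mxE add0r.
(* The margin [t] is [rho] standard deviations of the null statistic, whence the Chebyshev bound. *)
have -> : rho ^- 2 = d%:R * s2 / t ^+ 2.
  rewrite /t exprMn sqr_sqrtr ?(ltW ds0)//.
  by field; rewrite !gt_eqF.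
apply: le_trans (chebyshev_shift VE t0).
apply: le_measure; rewrite ?inE; first exact: measurable_rejects.
  exact: measurable_deviation.
move=> w; rewrite /rejects/= lq_norm_shift => H.
set S := \sum_i _ in H *.
have S0 : 0 <= S by apply: sumr_ge0 => i _; exact: powR_ge0.
have b0 : 0 <= t + d%:R * mu by rewrite addr_ge0 ?(ltW t0)// mulr_ge0.
have HS : t + d%:R * mu <= S.
  have := ler_powR2r p0 (powR_ge0 _ _) H.
  by rewrite -!powRrM mulVf ?powRr1// gt_eqF//; have := hp; lra.
rewrite (eq_bigr (fun=> mu)) => [|i _]; last first.
  rewrite mxE muE /normal_shift_moment /normal_moment; congr fine.
  by apply: eq_integral => e _; rewrite add0r.
rewrite sumr_const card_ord -mulr_natl.
apply: le_trans (ler_norm _); lra.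
Qed.

(* The mean of the test statistic exceeds its null value by at least
   [c0 * energy], half of which absorbs the term [rho * Num.sqrt (d * s2)] of the
   threshold as soon as [rho0 <= rho]. *)
Lemma type2_error_le : exists K rho0 : R, [/\ 0 <= K, 1 <= rho0 &
  forall d (theta : 'rV[R]_d) (rho : R), (0 < d)%N -> rho0 <= rho ->
    rho ^+ 2 * Num.sqrt d%:R <= energy p theta ->
  ((1 - K * rho `^ (- (4 / p)))%:E <=
   P (rejects eps p ((rho * Num.sqrt (d%:R * s2) + d%:R * mu) `^ p^-1) theta))%E].
Proof.
(* Merges the two moments of the variance bound into the single constant [m]. *)
have moments_le (x a b : R) : 0 <= x -> 0 <= a -> 0 <= b ->
    x * a + b <= (a + b) * (x + 1) by nra.
have pgt0 : 0 < p by have := hp; lra.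
have m2gt0 : 0 < normal_moment (p - 2) :> R.
  by apply: normal_moment_gt0; have := hp; lra.
have mu0 : 0 <= mu by rewrite muE normal_moment_ge0.
(* These are the coefficients of |x|^p and x^2 in [normal_shift_moment_ge] after division by 2;
   their minimum serves both terms. *)
pose c0 := Num.min 2^-1 (p / 4 * normal_moment (p - 2)).
have c0gt0 : 0 < c0 by rewrite lt_min invr_gt0 ltr0n mulr_gt0 ?divr_gt0.
have shift_ge x : mu + c0 * (x ^+ 2 + `|x| `^ p) <= normal_shift_moment p x.
  have := normal_shift_moment_ge x hp; rewrite -muE.
  have A1 : c0 * `|x| `^ p <= 2^-1 * `|x| `^ p.
    by rewrite ler_wpM2r ?powR_ge0// /c0 ge_min lexx.
  have A2 : c0 * x ^+ 2 <= p / 4 * normal_moment (p - 2) * x ^+ 2.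
    by rewrite ler_wpM2r ?sqr_ge0// /c0 ge_min lexx orbT.
  lra.
pose m := normal_moment 2 + normal_moment (2 * p) : R.
pose k := p ^+ 2 * 2 `^ (2 * p - 2).
have k0 : 0 <= k by apply: mulr_ge0; [exact: sqr_ge0|exact: powR_ge0].
have m0 : 0 <= m by apply: addr_ge0; exact: normal_moment_ge0.
pose Kv := k * m; have Kv0 : 0 <= Kv by exact: mulr_ge0.
(* The 8 is the 2 of [energy_noise_ratio_le] times the 4 from squaring t = c0 A / 2. The second
   entry of the maximum ensures rho sqrt(d s2) <= c0 rho^2 sqrt d / 2 <= t. *)
exists (8 * Kv / c0 ^+ 2), (Num.max 1 (2 * Num.sqrt s2 / c0)); split.
- by apply: divr_ge0; [exact: mulr_ge0|exact: sqr_ge0].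
- by rewrite le_max lexx.
move=> d theta rho d0' rho_ge HA; set A := energy p theta in HA.
have dR : 0 < d%:R :> R by rewrite ltr0n.
have rho1 : 1 <= rho by rewrite (le_trans _ rho_ge)// le_max lexx.
have rhoc : 2 * Num.sqrt s2 <= rho * c0.
  by rewrite -ler_pdivrMr// (le_trans _ rho_ge)// le_max lexx orbT.
have sd0 : 0 < Num.sqrt d%:R :> R by rewrite sqrtr_gt0.
have A0 : 0 < A by rewrite (lt_le_trans _ HA)// mulr_gt0// exprn_gt0//; lra.
pose t := c0 * A / 2.
have t0 : 0 < t by rewrite divr_gt0// mulr_gt0.
have base_le : rho * Num.sqrt (d%:R * s2) <= t.
  rewrite sqrtrM ?(ltW dR)// /t.
  have : c0 * (rho ^+ 2 * Num.sqrt d%:R) <= c0 * A by rewrite ler_wpM2l// ltW.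
  have : 2 * Num.sqrt s2 * (rho * Num.sqrt d%:R) <=
      rho * c0 * (rho * Num.sqrt d%:R).
    by rewrite ler_wpM2r// mulr_ge0 ?sqrtr_ge0//; lra.
  lra.
pose V := Kv * (A `^ (2 - 2 / p) + d%:R).
have VE : (\sum_(i < d) 'V_P[fun w => `|theta 0 i + eps i w| `^ p]%R <= V%:E)%E.
  apply: (@le_trans _ _
      (\sum_(i < d) (Kv * (`|theta 0 i| `^ (2 * p - 2) + 1))%:E)%E).
    apply: lee_sum => i _.
    have p1 : 1 < p by have := hp; lra.
    apply: le_trans (variance_shift_powR_le (heps.2 i) (theta 0 i) p1) _.
    rewrite lee_fin -/k /Kv -mulrA; apply: ler_wpM2l => //; rewrite /m.
    by apply: moments_le; rewrite ?powR_ge0 ?normal_moment_ge0.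
  rewrite sumEFin lee_fin -mulr_sumr ler_wpM2l// big_split/=.
  by rewrite lerD ?sum_powR_le_energy// sumr_const card_ord.
have Vt : V / t ^+ 2 <= 8 * Kv / c0 ^+ 2 * rho `^ (- (4 / p)).
  have d1 : 1 <= d%:R :> R by rewrite ler1n.
  have := energy_noise_ratio_le hp rho1 d1 HA => H.
  rewrite ler_pdivrMr ?exprn_gt0//.
  have -> : 8 * Kv / c0 ^+ 2 * rho `^ (- (4 / p)) * t ^+ 2 =
      Kv * (2 * A ^+ 2 * rho `^ (- (4 / p))).
    by rewrite /t; field; rewrite gt_eqF.
  exact: ler_wpM2l.
have mR := measurable_rejects ((rho * Num.sqrt (d%:R * s2) + d%:R * mu) `^ p^-1) theta.
rewrite -[X in (_ <= P X)%E]setCK probability_setC; last exact: measurableC.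
rewrite EFinB leeB//.
apply: le_trans (_ : ((V / t ^+ 2)%:E <= _)%E); last by rewrite lee_fin.
apply: le_trans (chebyshev_shift VE t0).
apply: le_measure; rewrite ?inE; first exact: measurableC.
  exact: measurable_deviation.
(* On acceptance the statistic is below d mu + t, while its mean is at least d mu + 2 t, so it
   deviates by at least t. *)
move=> w /= /negP; rewrite /rejects/= lq_norm_shift -ltNge => H.
set S := \sum_i `|_ + _| `^ _ in H *.
have b0 : 0 <= rho * Num.sqrt (d%:R * s2) + d%:R * mu.
  by rewrite addr_ge0// mulr_ge0 ?sqrtr_ge0 ?(ltW dR)//; lra.
have HS : S < rho * Num.sqrt (d%:R * s2) + d%:R * mu.
  rewrite ltNge; apply/negP => bS; move: H; apply/negP; rewrite -leNgt.
  by apply: ler_powR2r => //; rewrite invr_ge0.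
have HM : d%:R * mu + c0 * A <= \sum_i normal_shift_moment p (theta 0 i).
  have -> : d%:R * mu + c0 * A =
      \sum_i (mu + c0 * (theta 0 i ^+ 2 + `|theta 0 i| `^ p)).
    by rewrite big_split/= -mulr_sumr sumr_const card_ord mulr_natl.
  by apply: ler_sum => i _; exact: shift_ge.
rewrite distrC; apply: le_trans (ler_norm _).
have : c0 * A = 2 * t by rewrite /t; field.
lra.
Qed.

End power_test.

(** * From the error bounds to the limit *)

(** Positivity of the radii bounds the ratios below by 0, which makes the real [inf] a true lower
    bound. *)
Lemma inf_ratio_le (R : realType) (p q : R) (r : R -> nat -> R) (d : nat) :
  (forall q, 0 < q <= p -> 0 < r q d) -> (0 < d)%N -> 0 < q <= p ->
  inf_ratio p r d * critical_radius q d <= r q d.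
Proof.
move=> r0 d0 qp.
have cr0 q' : 0 < critical_radius q' d :> R.
  by rewrite /critical_radius; case: ifP => _; apply: powR_gt0; rewrite ltr0n.
rewrite -ler_pdivlMr//; apply: ge_inf.
  by exists 0 => _ [q' q'p <-]; rewrite divr_ge0 ?(ltW (cr0 _))// ltW// r0.
by exists q => //=; rewrite in_itv.
Qed.

(** Excludes an infimum over the empty set, which would be +oo; a single coordinate of the constant
    vector already has the required norm for q = p. *)
Lemma alternative_union_nonempty (R : realType) (p : R) (r : R -> nat -> R)
    (d : nat) : 0 < p -> 0 < r p d -> (0 < d)%N ->
  exists theta, @alternative_union R p r d theta.
Proof.
case: d => // d p0 r0 _; exists (const_mx (r p d.+1)).
exists p; first by rewrite /= in_itv/= p0 lexx.
rewrite /alternative /lq_norm/=.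
apply: (@le_trans _ _ ((`|r p d.+1| `^ p) `^ p^-1)).
  by rewrite -powRrM mulfV ?gt_eqF// powRr1// ler_norm.
apply: ler_powR2r; rewrite ?invr_ge0 ?(ltW p0) ?powR_ge0//.
rewrite big_ord_recl mxE lerDl; apply: sumr_ge0 => i _; exact: powR_ge0.
Qed.

Lemma cvg_powRN0 (R : realType) (f : nat -> R) (K s : R) : 0 < s -> 0 <= K ->
  f n @[n --> \oo] --> +oo%R -> K * f n `^ (- s) @[n --> \oo] --> (0 : R).
Proof.
move=> s0 K0 /cvgryPge foo; apply/cvgrPdist_le => /= e e0.
(* Solves e M^s = K + 1; the 1 keeps [M] positive when K = 0. *)
pose M := ((K + 1) / e) `^ s^-1.
have M0 : 0 < M by rewrite powR_gt0// divr_gt0//; lra.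
near=> n; rewrite sub0r normrN ger0_norm ?mulr_ge0 ?powR_ge0//.
have Mf : M <= f n by near: n; exact: foo.
rewrite powRN ler_pdivrMr ?powR_gt0 ?(lt_le_trans M0)//.
apply: (@le_trans _ _ (e * M `^ s)); last first.
  by rewrite ler_wpM2l ?(ltW e0)// ler_powR2r// ltW.
rewrite /M -powRrM mulVf ?gt_eqF// powRr1; last first.
  by rewrite divr_ge0 ?(ltW e0)//; lra.
by rewrite mulrC divfK ?gt_eqF//; lra.
Unshelve. all: by end_near. Qed.

Theorem theoremB1 (R : realType) (disp : measure_display)
    (T : measurableType disp) (P : probability T R)
    (eps : nat -> {RV P >-> R}) (p : R) (r : R -> nat -> R)
    (heps : iid_standard_normal eps)
    (hp : 2 < p)
    (hr : forall (q : R) (d : nat), 0 < q <= p -> (0 < d)%N -> 0 < r q d)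
    (hinf : inf_ratio p r d @[d --> \oo] --> +oo%R) :
  (P [set w | (kappa (eps 0%N) p r d <= lq_norm p (noise eps d w))%R] + 1
   - ereal_inf
       [set P (rejects eps p (kappa (eps 0%N) p r d) theta)
          | theta in alternative_union p r d])%E @[d --> \oo] --> 0%E.
Proof.
have p0 : 0 < p by lra.
have [K [rho0 [K0 rho01 type2]]] := type2_error_le heps hp.
pose rho := inf_ratio p r.
set f := (X in X @ _ --> _).
suff H : \forall d \near \oo,
    (0 <= f d <= ((1 + K) * rho d `^ (- (4 / p)))%:E)%E.
  apply: (squeeze_cvge H); first exact: cvg_cst.
  apply: cvg_EFin; first by near=> n.
  by apply: cvg_powRN0 => //; [exact: divr_gt0|lra].
near=> d.
have d0 : (0 < d)%N by near: d; exact: nbhs_infty_gt.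
have rho_ge : rho0 <= rho d by near: d; move/cvgryPge : hinf; apply.
have rho1 : 1 <= rho d by lra.
have type1 := type1_error_le heps hp d0 (lt_le_trans ltr01 rho1).
rewrite /f -/rho /kappa -/rho.
rewrite (_ : [set w | _] = rejects eps p (kappa (eps 0%N) p r d) (0 : 'rV[R]_d)); last first.
  by apply/seteqP; split => w; rewrite /rejects/= add0r.
set I := ereal_inf _.
have I_le : (I <= 1)%E.
  have pp : 0 < p <= p by rewrite p0 lexx.
  have [theta Htheta] := alternative_union_nonempty p0 (hr p d pp d0) d0.
  have I_theta : (I <= P (rejects eps p (kappa (eps 0%N) p r d) theta))%E.
    by apply: ereal_inf_lbound; exists theta.
  by apply: le_trans I_theta _; apply: probability_le1; exact: measurable_rejects.
have I_ge : ((1 - K * rho d `^ (- (4 / p)))%:E <= I)%E.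
  apply: le_ereal_inf_tmp => _ [theta [q /= qp Htheta] <-].
  rewrite in_itv/= in qp.
  apply: type2 => //; apply: (energy_alternative_ge d0 hp qp rho1 _ Htheta).
  by apply: inf_ratio_le => // q' q'p; exact: hr.
(* Finiteness allows the sign of 1 - I to be read off from I <= 1 in the extended reals. *)
have I_fin : I \is a fin_num.
  by rewrite fin_numE; apply/andP; split; apply/eqP => IE;
    [move: I_ge|move: I_le]; rewrite IE.
apply/andP; split.
  by rewrite -addeA adde_ge0// sube_ge0 ?I_fin.
apply: (@le_trans _ _ ((rho d ^- 2)%:E + 1 - (1 - K * rho d `^ (- (4 / p)))%:E)%E).
  by apply: leeB => //; apply: leeD.
rewrite [leLHS](_ : _ = (rho d ^- 2 + 1 - (1 - K * rho d `^ (- (4 / p))))%:E)//.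
rewrite lee_fin.
(* As p > 2 gives 4/p <= 2, the type II rate dominates, and the constants add up to 1 + K. *)
have : rho d ^- 2 <= rho d `^ (- (4 / p)).
  rewrite powRN lef_pV2 ?posrE ?powR_gt0 ?exprn_gt0//; [|lra|lra].
  rewrite -powR_mulrn; last lra.
  by apply: ler_powR => //; rewrite ler_pdivrMr//; lra.
lra.
Unshelve. all: by end_near. Qed.
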